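(* Let $p$ be a prime and $r\geq 1$. Any nontrivial irreducible representation $V$ of $G:=\mathrm{SL}_2(p^r)$ over $\overline{\mathbb{F}}_p$ is weakly adequate, except when $q:=p^r\le3$.
   Context: A representation $\rho:G\to\mathrm{GL}(V)$ is weakly adequate if $\mathrm{End}(V)$ is spanned by the elements $\rho(g)$, $g\in G$, with $\rho(g)$ semisimple. The proposition asserts weak adequacy for all $q>3$. *)

(* Defs.v *)
From mathcomp Require Import all_boot all_order all_algebra all_fingroup.
From mathcomp Require Import mxrepresentation.
From mathcomp Require Import boolp.

Set Implicit Arguments.
Unset Strict Implicit.
Unset Printing Implicit Defensive.

Import GRing.Theory.
Local Open Scope group_scope.
Local Open Scope ring_scope.

Definition SL2 (F : finFieldType) : {set {'GL_2[F]}} :=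
  [set g | \det (GLval g) == 1].

Lemma SL2_group_set (F : finFieldType) : group_set (SL2 F).
Proof.
apply/group_setP; split; first by rewrite inE det1.
move=> g h; rewrite !inE => /eqP dg /eqP dh.
by rewrite GL_MxE det_mulmx dg dh mulr1.
Qed.

Canonical SL2_group (F : finFieldType) : {group {'GL_2[F]}} :=
  Group (SL2_group_set F).

(* Every stable subspace has a stable complement; as in the library, M acts on
   row vectors on the right and a subspace is the row space of a matrix. *)
Definition semisimple_mx (K : fieldType) (n : nat) (M : 'M[K]_n) : Prop :=
  forall U : 'M[K]_n, stablemx U M ->
  exists W : 'M[K]_n,
    [/\ stablemx W M, (U + W :=: 1%:M)%MS & mxdirect (U + W)].

Definition nontrivial_repr (K : fieldType) (gT : finGroupType) (G : {group gT})
    (n : nat) (rG : mx_representation K G n) : Prop :=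
  rker rG != G.

Definition weakly_adequate (K : fieldType) (gT : finGroupType) (G : {group gT})
    (n : nat) (rG : mx_representation K G n) : Prop :=
  <<[seq rG g | g in [pred g in G | `[< semisimple_mx (rG g) >]]]>>%VS
    = fullv :> {vspace 'M[K]_n}.

(* Together with the algebraic closedness of K, this says that K is an
   algebraic closure of F. *)
Definition algebraic_over (F K : fieldType) (iota : {rmorphism F -> K}) : Prop :=
  forall x : K, algebraicOver iota x.

(* Main.v *)
Require Import Defs.
From HB Require Import structures.
From mathcomp Require Import all_boot all_order all_algebra all_fingroup.
From mathcomp Require Import all_field mxrepresentation.
From mathcomp Require Import boolp ring cyclic pgroup.

Set Implicit Arguments.
Unset Strict Implicit.
Unset Printing Implicit Defensive.

Import GRing.Theory.
Local Open Scope ring_scope.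

(** The span of the semisimple rho(g) is everything as soon as every linear form
    f on End(V) killing them is zero. In SL_2(F), with F of characteristic p,
    an element of trace other than 2 and -2 has order prime to p
    ([trace_of_p_element]), so it acts semisimply by Maschke's theorem. Thus
    g |-> f(rho(g)) vanishes at 1 and off the traces 2 and -2; it will be shown
    to vanish on all of SL_2(F), and then f = 0 by Burnside's theorem.

    Let U x, L y, T t, W be the images of the upper and lower unipotents, of
    diag(t, 1/t) and of the Weyl element. The forms in question are stable under
    conjugation, and the matrices U x form a p-group, so f may be taken invariant
    under conjugation by them ([moment_fixed]). Outside the Borel subgroup
    f(rho(g)) then depends only on the trace t of g and on its lower left entry
    c; call it phi t c. Only phi 2 c and phi (-2) c can be nonzero. Fix an
    embedding j of F in K and a highest weight vector v (fixed by the U x, an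
    eigenvector of T); by the Bruhat decomposition V is spanned by v and the
    v W U x, so an operator is known from its values on these. Everything then
    turns on N0 = sum_x U x.

    If N0 = 0, each coset gU gives sum_t phi t c = 0, which settles p = 2 and
    gives phi (-2) c = - phi 2 c otherwise. Moreover N1 = sum_x j(x) U x is a
    torus eigenvector ([TN1]), which forces phi 2 c = psi(c) phi 2 1 for a
    character psi of F^*; the cosets of the lower unipotents force psi^2 = 1
    and psi to be nontrivial, unless phi 2 1 = 0. But for such a psi the
    relation expressing v through the v W U x, convolved with psi, gives
    N1 = 0 because a Jacobi sum is nonzero; and N1 = 0 kills phi 2 1 again
    ([phi2_1_eq0]).

    If N0 <> 0, V behaves like the Steinberg module: the weight of v is trivial,
    N0 absorbs the Borel subgroup on both sides, and the identity is the sum of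
    the conjugates of N0 over the points of the projective line
    ([relative_trace_N0]). Expanding f(rho(g)) along this sum expresses all the
    phi t c by a single function kappa on F ([phiE]):
      phi t c = C + sum_(s <> 0) kappa ((t - s - 1/s) / c).
    Only t = 2 and t = -2 contribute to the power moments in t of the left-hand
    side, while those of the right-hand side are polynomials in c. The moments of
    order 0, 1 and 3 are incompatible unless these phi vanish; here |F| > 3
    enters, through the existence of an s in F^* with s^2 <> 1. *)

(** * Sums over a finite field *)

Section SumReindexing.

Variables (F : finFieldType) (V : nmodType) (G : F -> V).

Lemma sum_nz_mul s : s != 0 ->
  \sum_(t | t != 0) G t = \sum_(t | t != 0) G (t * s).
Proof.
move=> s0; rewrite (reindex_inj (mulIf s0)) /=.
by apply: eq_bigl => t; rewrite mulf_eq0 (negPf s0) orbF.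
Qed.

Lemma sum_nz_inv : \sum_(t | t != 0) G t = \sum_(t | t != 0) G t^-1.
Proof.
rewrite (reindex_inj invr_inj) /=.
by apply: eq_bigl => t; rewrite invr_eq0.
Qed.

Lemma sum_shift s : \sum_t G t = \sum_t G (t + s).
Proof. exact: (reindex_inj (addIr s)). Qed.

Lemma sum_scale s : s != 0 -> \sum_t G t = \sum_t G (t * s).
Proof. by move=> s0; exact: (reindex_inj (mulIf s0)). Qed.

Lemma sum_opp : \sum_t G t = \sum_t G (- t).
Proof. exact: (reindex_inj oppr_inj). Qed.

End SumReindexing.

Section PowerSums.

Variables (F : finFieldType) (K : fieldType) (j : {rmorphism F -> K}).

Lemma natr_card : #|F|%:R = 0 :> K.
Proof.
suff: #|F|%:R = 0 :> F by move=> /(congr1 j); rewrite rmorph_nat rmorph0.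
have := sum_shift id (1 : F).
rewrite big_split /= sumr_const -[LHS]addr0 => /addrI.
by move=> ->; rewrite cardT.
Qed.

Lemma natr_card_pred : #|F|.-1%:R = -1 :> K.
Proof.
apply/eqP; rewrite -subr_eq0 opprK natr1.
by rewrite prednK ?natr_card //; apply/card_gt0P; exists 0.
Qed.

Lemma sum_char0 (psi : F -> K) s : s != 0 ->
    (forall x, psi (x * s) = psi x * psi s) -> psi s != 1 ->
  \sum_(x | x != 0) psi x = 0.
Proof.
move=> s0 psiM psi1; have := sum_nz_mul psi s0.
under [RHS]eq_bigr do rewrite psiM.
rewrite -mulr_suml -{1}[\sum_(_ | _) _]mulr1 => /eqP.
rewrite -subr_eq0 -mulrBr mulf_eq0 [1 - _ == 0]subr_eq0 eq_sym.
by case/orP => [/eqP|/eqP psi1'] //; rewrite psi1' eqxx in psi1.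
Qed.

Lemma exists_expf_neq1 k : (0 < k < #|F|.-1)%N -> exists2 s : F, s != 0 & s ^+ k != 1.
Proof.
case/andP=> k0 kq; apply/exists2P; apply: contraTP kq => noS.
rewrite -leqNgt.
have pol0 : 'X^k - 1 != 0 :> {poly F}.
  by rewrite -size_poly_eq0 -polyC1 size_XnsubC.
have := @max_poly_roots _ _ (enum (predC1 (0 : F))) pol0.
rewrite -polyC1 size_XnsubC // ltnS -cardE cardC1; apply; last exact: enum_uniq.
apply/allP=> s; rewrite mem_enum inE /= => s0.
rewrite rootE !hornerE subr_eq0; apply: contra_notT noS => s1.
by exists s.
Qed.

Lemma sum_nz_expf0 k : (0 < k < #|F|.-1)%N -> \sum_(x | x != 0) j x ^+ k = 0.
Proof.
move=> /[dup] /andP[k0 _] /exists_expf_neq1[s s0 s1].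
apply: (@sum_char0 (fun x => j x ^+ k) s) => // [x|].
  by rewrite rmorphM exprMn.
by rewrite -rmorphXn fmorph_eq1.
Qed.

Lemma sum_nz_const (V : lmodType K) (v : V) : \sum_(x : F | x != 0) v = - v.
Proof.
rewrite sumr_const (_ : #|_| = #|F|.-1); last by rewrite -(cardC1 (0 : F)).
by rewrite -scaler_nat natr_card_pred scaleN1r.
Qed.

Lemma sum_const0 (V : lmodType K) (v : V) : \sum_(x : F) v = 0.
Proof. by rewrite sumr_const -scaler_nat natr_card scale0r. Qed.

Lemma sum_nz_constK (a : K) : \sum_(x : F | x != 0) a = - a.
Proof. exact: (sum_nz_const (a : K^o)). Qed.

Lemma sum_const0K (a : K) : \sum_(x : F) a = 0.
Proof. exact: (sum_const0 (a : K^o)). Qed.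

Lemma sum_expf0 k : (k < #|F|.-1)%N -> \sum_x j x ^+ k = 0.
Proof.
case: k => [_|k kq].
  by under eq_bigr do rewrite expr0; rewrite sum_const0K.
by rewrite (bigD1 0) //= rmorph0 expr0n add0r sum_nz_expf0.
Qed.

(** Applied to an orbit map e of the additive group of F, this produces a nonzero
    fixed vector in the span of the orbit, replacing the usual counting argument
    for p-groups. Take the least k with nonzero k-th moment: translating by y
    changes it by lower moments only. Some moment is nonzero because
    1 - x^(q-1) is the indicator function of 0. *)
Lemma moment_fixed (V : lmodType K) (e : F -> V) : e 0 != 0 ->
  exists k, \sum_x j x ^+ k *: e x != 0 /\
    forall y, \sum_x j x ^+ k *: e (x + y) = \sum_x j x ^+ k *: e x.
Proof.
move=> e0.
have ex : exists k, \sum_x j x ^+ k *: e x != 0.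
  apply: contraPP e0 => /forallNP noK; apply/negP; rewrite negbK.
  have mom k : \sum_x j x ^+ k *: e x = 0 by apply/eqP/negPn/negP/noK.
  have := mom 0; rewrite (bigD1 0) //= expr0 scale1r => /eqP.
  rewrite addr_eq0 => /eqP ->; rewrite oppr_eq0; apply/eqP.
  rewrite -[RHS](mom #|F|.-1) [RHS](bigD1 0) //= rmorph0 expr0n.
  have q1 : (1 < #|F|)%N.
    by rewrite (cardD1 0) (cardD1 1) !inE oner_eq0.
  rewrite -subn1 subn_eq0 leqNgt q1 scale0r add0r.
  apply: eq_bigr => x x0; rewrite expr0 subn1 -rmorphXn.
  suff -> : x ^+ #|F|.-1 = 1 by rewrite rmorph1.
  apply: (mulfI x0); rewrite -exprS prednK ?expf_card ?mulr1 //; exact: ltnW.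
have [k nz mini] := ex_minnP ex.
(* Expand (x - y)^k: the terms with a lower power of x vanish by minimality. *)
exists k; split=> // y; rewrite (sum_shift _ (- y)).
under eq_bigr => x _ do
  rewrite addrNK rmorphD exprDn big_ord_recl subn0 expr0 mulr1 bin0 mulr1n scalerDl.
rewrite big_split /= [X in _ + X](_ : _ = 0) ?addr0 //.
under eq_bigr => x _ do rewrite scaler_suml.
rewrite exchange_big big1 //= => i _.
under eq_bigr => x _ do rewrite -mulr_natr mulrAC -mulrA mulrC -scalerA.
rewrite -scaler_sumr; apply/eqP; rewrite scaler_eq0; apply/orP; right.
apply/negPn/negP => /mini; rewrite leqNgt ltn_subrL /=.
by case: (k) (i) => // -[].
Qed.

(** The same for an orbit map of the multiplicative group: the sums over t
    weighted by the characters t |-> t^-k are eigenvectors, and adding them up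
    over all k gives back - e 1, by orthogonality of characters. *)
Lemma weight_vector (V : lmodType K) (e : F -> V) : e 1 != 0 ->
  exists k, \sum_(t | t != 0) j t^-1 ^+ k *: e t != 0.
Proof.
move=> e1; apply: contrapT => /forallNP noK.
case/negP: e1; rewrite -oppr_eq0.
have mom k : \sum_(t | t != 0) j t^-1 ^+ k *: e t = 0 by apply/eqP/negPn/negP/noK.
suff <- : \sum_(k < #|F|.-1) \sum_(t | t != 0) j t^-1 ^+ k *: e t = - e 1.
  by rewrite big1 // => k _; rewrite mom.
rewrite exchange_big /=; under eq_bigr do rewrite -scaler_suml.
rewrite (bigD1 1) ?oner_eq0 //= invr1 rmorph1.
under eq_bigr do rewrite expr1n.
rewrite sumr_const card_ord natr_card_pred scaleN1r big1 ?addr0 // => t /andP[t0 t1].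
suff -> : \sum_(k < #|F|.-1) j t^-1 ^+ k = 0 by rewrite scale0r.
have t1' : j t^-1 - 1 != 0 by rewrite subr_eq0 fmorph_eq1 invr_eq1.
apply: (mulfI t1'); rewrite -subrX1 mulr0 -rmorphXn.
suff -> : t^-1 ^+ #|F|.-1 = 1 by rewrite rmorph1 subrr.
have ti : t^-1 != 0 by rewrite invr_eq0.
apply: (mulfI ti); rewrite -exprS prednK ?expf_card ?mulr1 //.
by apply/card_gt0P; exists 0.
Qed.

End PowerSums.

(** * Quadratic characters *)

Section QuadraticCharacter.

Variables (F : finFieldType) (K : fieldType) (j : {rmorphism F -> K}).
Variable psi : F -> K.
Hypotheses (psi0 : psi 0 = 0) (psiM : forall x y, psi (x * y) = psi x * psi y).
Hypothesis psi_sq : forall x, x != 0 -> psi x ^+ 2 = 1.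
Hypothesis psi_sum : \sum_x psi x = 0.

Definition jacobi : K := \sum_u j u * psi u * psi (1 - u).

(** The substitution u |-> 1 - u shows that twice the sum is the classical
    Jacobi sum of psi with itself, which is - psi (-1). *)
Lemma jacobi_neq0 : jacobi != 0.
Proof.
suff J2 : jacobi + jacobi = - psi (-1).
  apply/eqP=> J0; move/eqP: J2; rewrite J0 addr0 eq_sym oppr_eq0 => /eqP p1.
  have m1_neq0 : -1 != 0 :> F by rewrite oppr_eq0 oner_eq0.
  by move/eqP: (psi_sq m1_neq0); rewrite p1 expr0n eq_sym oner_eq0.
rewrite {2}/jacobi sum_opp (sum_shift _ (-1)) /jacobi -big_split /=.
(* psi(u) psi(1 - u) = psi(u)^2 psi((1 - u) / u) *)
transitivity (\sum_(u | u != 0) psi (u^-1 - 1)).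
  rewrite [LHS](bigD1 0) //= rmorph0 psi0 !mul0r.
  rewrite (_ : 1 - - (0 - 1) = 0); last by ring.
  rewrite psi0 mulr0 !add0r; apply: eq_bigr => u u0.
  have -> : - (u - 1) = 1 - u by ring.
  have -> : 1 - (1 - u) = u by ring.
  rewrite rmorphB rmorph1 (_ : u^-1 - 1 = (1 - u) / u); last by field.
  transitivity (psi (1 - u) * psi u); first by ring.
  rewrite psiM; congr (_ * _); rewrite -[RHS]mul1r -(psi_sq u0) expr2 -mulrA -psiM.
  have p1 : psi 1 = 1.
    have := psi_sq (oner_neq0 F); rewrite expr2 -psiM mulr1 => //.
  by rewrite divff // p1 mulr1.
rewrite -(sum_nz_inv (fun u => psi (u - 1))).
have := psi_sum; rewrite (sum_shift _ (-1)) (bigD1 0) //= add0r => /eqP.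
by rewrite addrC addr_eq0 => /eqP.
Qed.

(** The additive convolution of x psi(x) with psi is a multiple of the identity
    function x, by homogeneity. *)
Lemma jacobi_convolution (V : lmodType K) (G : F -> V) : (2 < #|F|)%N ->
  \sum_x \sum_y (j x * psi x * psi y) *: G (x + y) =
  jacobi *: \sum_z j z *: G z.
Proof.
move=> q2; pose H x z := (j x * psi x * psi (z - x)) *: G z.
transitivity (\sum_x \sum_z H x z).
  apply: eq_bigr => x _; rewrite [LHS](sum_shift _ (- x)).
  by apply: eq_bigr => z _; rewrite /H [x + _]addrC addrNK.
rewrite exchange_big scaler_sumr; apply: eq_bigr => z _.
rewrite -scaler_suml scalerA; congr (_ *: _).
have [->|z0] := eqVneq z 0.
  rewrite rmorph0 mulr0; transitivity (psi (-1) * \sum_x j x ^+ 1).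
    rewrite mulr_sumr; apply: eq_bigr => x _.
    have [->|x0] := eqVneq x 0; first by rewrite rmorph0 !mul0r mulr0.
    rewrite sub0r -[- x]mulN1r psiM; transitivity (j x * psi (-1) * psi x ^+ 2); first by ring.
    by rewrite psi_sq //; ring.
  by rewrite sum_expf0 ?mulr0 // -subn1 ltn_subRL.
rewrite (@sum_scale _ _ _ z) // /jacobi mulr_suml; apply: eq_bigr => u _.
rewrite (_ : z - u * z = (1 - u) * z); last by ring.
rewrite rmorphM !psiM.
transitivity (j u * psi u * psi (1 - u) * j z * psi z ^+ 2); first by ring.
by rewrite psi_sq //; ring.
Qed.

End QuadraticCharacter.

(** * Elements of SL_2 and their relations *)

Section Matrices.

Variable F : finFieldType.
Implicit Types a b c d : F.

Definition mx2 a b c d : 'M[F]_2 :=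
  \matrix_(i, k) if i == 0 then if k == 0 then a else b
                 else if k == 0 then c else d.

Lemma mx2_eq (A : 'M[F]_2) : A = mx2 (A 0 0) (A 0 1) (A 1 0) (A 1 1).
Proof.
apply/matrixP=> i k; rewrite mxE.
by case: i => [[|[|//]]] ?; case: k => [[|[|//]]] ?; congr (A _ _); apply: val_inj.
Qed.

Lemma det_mx2 a b c d : \det (mx2 a b c d) = a * d - b * c.
Proof.
rewrite (expand_det_row _ 0) !big_ord_recl big_ord0 /cofactor !det_mx11 !mxE /=.
by rewrite addr0 expr0 mul1r expr1 mulN1r mulrN.
Qed.

Lemma tr_mx2 a b c d : \tr (mx2 a b c d) = a + d.
Proof. by rewrite /mxtrace !big_ord_recl big_ord0 !mxE /= addr0. Qed.

Lemma mul_mx2 a b c d a' b' c' d' :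
  mx2 a b c d *m mx2 a' b' c' d' =
  mx2 (a * a' + b * c') (a * b' + b * d') (c * a' + d * c') (c * b' + d * d').
Proof.
apply/matrixP=> i k; rewrite !mxE !big_ord_recl big_ord0 !mxE addr0.
by case: i => [[|[|//]]] ?; case: k => [[|[|//]]] ?.
Qed.

Lemma mx2_id : mx2 1 0 0 1 = 1%:M.
Proof.
apply/matrixP=> i k; rewrite !mxE.
by case: i => [[|[|//]]] ?; case: k => [[|[|//]]] ?.
Qed.

(** Meaningful only when a * d - b * c = 1; the default value lets matrices be
    written entry by entry without carrying the proof. *)
Definition sl2 a b c d : {'GL_2[F]} := insubd (1%g : {'GL_2[F]}) (mx2 a b c d).

Lemma val_sl2 a b c d : a * d - b * c = 1 -> GLval (sl2 a b c d) = mx2 a b c d.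
Proof.
by move=> D; rewrite insubdK // unitmxE det_mx2 D unitr1.
Qed.

Lemma sl2_in a b c d : a * d - b * c = 1 -> sl2 a b c d \in SL2_group F.
Proof. by move=> D; rewrite inE val_sl2 // det_mx2 D. Qed.

Lemma sl2P g : g \in SL2_group F ->
  exists a b c d, a * d - b * c = 1 /\ g = sl2 a b c d.
Proof.
rewrite inE => /eqP; move: (mx2_eq (GLval g)).
set a := _ 0 0; set b := _ 0 1; set c := _ 1 0; set d := _ 1 1 => gE.
rewrite gE det_mx2 => D; exists a, b, c, d; split=> //.
by apply: val_inj; rewrite /= val_sl2.
Qed.

End Matrices.

Section Action.

Variables (F : finFieldType) (K : fieldType) (n : nat).
Variable rG : mx_representation K (SL2_group F) n.
Implicit Types a b c d x y z t : F.

Definition rho a b c d : 'M[K]_n := rG (sl2 a b c d).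

Lemma rho1 : rho 1 0 0 1 = 1%:M.
Proof.
rewrite /rho (_ : sl2 _ _ _ _ = 1%g) ?repr_mx1 //.
by apply: val_inj; rewrite /= val_sl2 ?mx2_id //; ring.
Qed.

(** The entries of the product are left free, so that each concrete relation
    between group elements reduces to identities in F. *)
Lemma rhoM a b c d a' b' c' d' a'' b'' c'' d'' :
    a * d - b * c = 1 -> a' * d' - b' * c' = 1 ->
    a * a' + b * c' = a'' -> a * b' + b * d' = b'' ->
    c * a' + d * c' = c'' -> c * b' + d * d' = d'' ->
  rho a b c d *m rho a' b' c' d' = rho a'' b'' c'' d''.
Proof.
move=> D D' <- <- <- <-; rewrite /rho -repr_mxM ?sl2_in //; congr (rG _).
apply: val_inj; transitivity (mx2 a b c d *m mx2 a' b' c' d').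
  by rewrite -(val_sl2 D) -(val_sl2 D').
rewrite mul_mx2; symmetry; apply: val_sl2.
by rewrite -[RHS]mulr1 -{1}D -D'; ring.
Qed.

Definition upper x := rho 1 x 0 1.
Definition lower y := rho 1 0 y 1.
Definition torus t := rho t 0 0 t^-1.
Definition weyl := rho 0 (-1) 1 0.
Local Notation U := upper.
Local Notation L := lower.
Local Notation T := torus.
Local Notation W := weyl.

Lemma U0 : U 0 = 1%:M. Proof. exact: rho1. Qed.
Lemma L0 : L 0 = 1%:M. Proof. exact: rho1. Qed.

Lemma UD x y : U x *m U y = U (x + y).
Proof. by apply: rhoM; ring. Qed.

Lemma TM s t : s != 0 -> t != 0 -> T s *m T t = T (s * t).
Proof. by move=> s0 t0; apply: rhoM; field; rewrite ?s0 ?t0. Qed.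

Lemma T1 : T 1 = 1%:M. Proof. by rewrite /torus invr1 rho1. Qed.

Lemma TU t x : t != 0 -> T t *m U x = U (x * t ^+ 2) *m T t.
Proof.
move=> t0; rewrite (@rhoM _ _ _ _ _ _ _ _ t (t * x) 0 t^-1); try by field.
by symmetry; apply: rhoM; field.
Qed.

Lemma WT t : t != 0 -> W *m T t = T t^-1 *m W.
Proof.
move=> t0; rewrite (@rhoM _ _ _ _ _ _ _ _ 0 (- t^-1) t 0); try by field.
by symmetry; apply: rhoM; field; rewrite ?oner_eq0 ?t0.
Qed.

Lemma WW : W *m W = T (-1).
Proof. by apply: rhoM; rewrite ?invrN1; ring. Qed.

Lemma WU x : W *m U x = L (- x) *m W.
Proof.
rewrite (@rhoM _ _ _ _ _ _ _ _ 0 (-1) 1 x); try by ring.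
by symmetry; apply: rhoM; ring.
Qed.

Lemma bruhat a b c d : a * d - b * c = 1 -> c != 0 ->
  rho a b c d = U (a / c) *m T c^-1 *m W *m U (d / c).
Proof.
move=> D c0; have bE : b = (a * d - 1) / c by rewrite -D; field.
rewrite (@rhoM _ _ _ _ _ _ _ _ c^-1 a 0 c); try by field; rewrite ?oner_eq0 ?c0.
rewrite (@rhoM _ _ _ _ _ _ _ _ a (-c^-1) c 0); try by field; rewrite ?oner_eq0 ?c0.
by symmetry; apply: rhoM; rewrite ?bE; field.
Qed.

Lemma upper_conj x a b c d : a * d - b * c = 1 ->
  U x *m rho a b c d *m U (- x) =
  rho (a + x * c) (b + x * (d - a) - x ^+ 2 * c) c (d - x * c).
Proof.
move=> D.
have -> : U x *m rho a b c d = rho (a + x * c) (b + x * d) c d.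
  by apply: rhoM => //; ring.
by apply: rhoM; try ring; rewrite -D; ring.
Qed.

Lemma borel a b d : a * d = 1 -> rho a b 0 d = T a *m U (b / a).
Proof.
move=> D; have a0 : a != 0.
  by apply: contra_eq_neq D => ->; rewrite mul0r eq_sym oner_eq0.
have -> : d = a^-1 by apply: (mulfI a0); rewrite D divff.
by symmetry; apply: rhoM; field.
Qed.

End Action.

(** * Unipotent sums and highest weight vectors *)

Section Sums.

Variables (F : finFieldType) (K : fieldType) (j : {rmorphism F -> K}) (n : nat).
Variable rG : mx_representation K (SL2_group F) n.
Local Notation U := (upper rG).
Local Notation L := (lower rG).
Local Notation T := (torus rG).
Local Notation W := (weyl rG).

Definition upper_sum : 'M[K]_n := \sum_x U x.
Definition upper_moment : 'M[K]_n := \sum_x j x *: U x.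
Definition lower_sum : 'M[K]_n := \sum_y L y.
Local Notation N0 := upper_sum.
Local Notation N1 := upper_moment.
Local Notation M0 := lower_sum.

Lemma UN0 y : U y *m N0 = N0.
Proof.
rewrite mulmx_sumr [RHS](sum_shift _ y).
by apply: eq_bigr => x _; rewrite UD addrC.
Qed.

Lemma N0U y : N0 *m U y = N0.
Proof.
rewrite mulmx_suml [RHS](sum_shift _ y).
by apply: eq_bigr => x _; rewrite UD.
Qed.

Lemma TN0 t : t != 0 -> T t *m N0 = N0 *m T t.
Proof.
move=> t0; rewrite mulmx_sumr mulmx_suml [RHS](@sum_scale _ _ _ (t ^+ 2)).
  by apply: eq_bigr => x _; rewrite TU.
by rewrite expf_eq0.
Qed.

Lemma UN1 y : U y *m N1 = N1 - j y *: N0.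
Proof.
rewrite mulmx_sumr (sum_shift _ (- y)) scaler_sumr -sumrB.
by apply: eq_bigr => x _; rewrite -scalemxAr UD [y + _]addrC addrNK rmorphB scalerBl.
Qed.

Lemma N1T t : t != 0 -> N1 *m T t = j t ^+ 2 *: (T t *m N1).
Proof.
move=> t0; rewrite mulmx_sumr mulmx_suml [LHS](@sum_scale _ _ _ (t ^+ 2)).
  rewrite scaler_sumr; apply: eq_bigr => x _.
  by rewrite -scalemxAr TU // scalerA rmorphM rmorphXn mulrC -scalemxAl.
by rewrite expf_eq0.
Qed.

Lemma M0W : M0 *m W = W *m N0.
Proof.
rewrite mulmx_sumr mulmx_suml [LHS]sum_opp.
by apply: eq_bigr => x _; rewrite WU.
Qed.

End Sums.

Section HighestWeight.

Variables (F : finFieldType) (K : fieldType) (j : {rmorphism F -> K}) (n : nat).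
Variable rG : mx_representation K (SL2_group F) n.
Hypothesis irrG : mx_irreducible rG.
Local Notation U := (upper rG).
Local Notation L := (lower rG).
Local Notation T := (torus rG).
Local Notation W := (weyl rG).
Local Notation N0 := (upper_sum rG).
Local Notation N1 := (upper_moment j rG).
Local Notation M0 := (lower_sum rG).

(** The vectors u such that u *m rG g *m Z = 0 for all g form a submodule. *)
Lemma irr_ext k (v : 'rV[K]_n) (Z : 'M[K]_(n, k)) : v != 0 ->
  (forall g, g \in SL2_group F -> v *m rG g *m Z = 0) -> Z = 0.
Proof.
move=> v0 vZ.
pose S := (\bigcap_(g in SL2_group F) kermx (rG g *m Z))%MS.
have vS : (v <= S)%MS.
  by apply/sub_bigcapmxP => g gG; apply/sub_kermxP; rewrite mulmxA vZ.
have modS : mxmodule rG S.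
  apply/mxmoduleP=> h hG; apply/sub_bigcapmxP => g gG; apply/sub_kermxP.
  rewrite mulmxA -[S *m _ *m _]mulmxA -repr_mxM //.
  have /sub_kermxP : (S <= kermx (rG (h * g)%g *m Z))%MS.
    exact: bigcapmx_inf (groupM hG gG) (submx_refl _).
  by rewrite mulmxA.
have /mx_irrP[n0 simS] := irrG.
have S0 : S != 0 by apply: contraNneq v0 => S0; rewrite S0 submx0 in vS.
have Sfull : (1%:M <= S)%MS by rewrite sub1mx simS.
have : (1%:M <= kermx (rG 1%g *m Z))%MS.
  apply: submx_trans Sfull _; rewrite /S.
  exact: (@bigcapmx_inf _ _ 1%g _ _ _ _ _ (group1 _) (submx_refl _)).
by move/sub_kermxP; rewrite repr_mx1 !mul1mx.
Qed.

Definition highest_weight (m : nat) (v : 'rV[K]_n) :=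
  [/\ v != 0, forall x, v *m U x = v
    & forall t, t != 0 -> v *m T t = j t ^+ m *: v].

Lemma highest_weight_exists : exists m v, highest_weight m v.
Proof.
have /mx_irrP[n0 _] := irrG.
have [v v0] : exists v : 'rV[K]_n, v != 0.
  by exists (const_mx 1); apply/eqP=> /rowP/(_ (Ordinal n0)); rewrite !mxE => /eqP; rewrite oner_eq0.
have : v *m U 0 != 0 by rewrite U0 mulmx1.
case/(moment_fixed j (e := fun x => v *m U x)) => k []; set w := \sum_x _ => w0 wU.
have {}wU y : w *m U y = w.
  rewrite -{2}(wU y) mulmx_suml; apply: eq_bigr => x _.
  by rewrite -scalemxAl -mulmxA UD.
have : w *m T 1 != 0 by rewrite T1 mulmx1.
case/(weight_vector j (e := fun t => w *m T t)) => m; set u := \sum_(t | _) _ => u0.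
exists m, u; split=> // [x|s s0].
  rewrite mulmx_suml; apply: eq_bigr => t t0.
  by rewrite -scalemxAl -mulmxA TU // mulmxA wU.
rewrite mulmx_suml scaler_sumr [RHS](sum_nz_mul _ s0); apply: eq_bigr => t t0.
rewrite -scalemxAl -mulmxA TM // scalerA -exprMn -rmorphM; congr (j _ ^+ _ *: _).
by rewrite invfM mulrCA mulfV ?mulr1.
Qed.

Variables (m : nat) (v : 'rV[K]_n).
Hypothesis hv : highest_weight m v.

Lemma hw_bruhat a b c d : a * d - b * c = 1 -> c != 0 ->
  v *m rho rG a b c d = j c^-1 ^+ m *: (v *m W *m U (d / c)).
Proof.
move=> D c0; have [_ vU vT] := hv.
by rewrite bruhat // !mulmxA vU vT ?invr_eq0 // -!scalemxAl.
Qed.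

Lemma hw_borel a b d : a * d = 1 -> v *m rho rG a b 0 d = j a ^+ m *: v.
Proof.
move=> D; have [_ vU vT] := hv; rewrite borel // mulmxA vT -?scalemxAl ?vU //.
by apply: contra_eq_neq D => ->; rewrite mul0r eq_sym oner_eq0.
Qed.

(** By the Bruhat decomposition the lines of the v *m rG g are those of v and of
    the v *m W *m U x. *)
Lemma hw_ext k (Z : 'M[K]_(n, k)) :
  v *m Z = 0 -> (forall x, v *m W *m U x *m Z = 0) -> Z = 0.
Proof.
move=> vZ vWZ; have [v0 _ _] := hv; apply: (irr_ext v0) => g /sl2P[a [b [c [d [D ->]]]]].
rewrite -/(rho rG a b c d); have [c0|c0] := eqVneq c 0.
  by move: D; rewrite c0 mulr0 subr0 => D; rewrite hw_borel // -scalemxAl vZ scaler0.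
by rewrite hw_bruhat // -scalemxAl vWZ scaler0.
Qed.

(** Passing from the lower to the upper unipotents replaces the parameter by its
    inverse. *)
Lemma hw_L x : x != 0 -> v *m L x^-1 = j x ^+ m *: (v *m W *m U x).
Proof.
by move=> x0; rewrite hw_bruhat ?invr_eq0 ?invrK ?mul1r //; ring.
Qed.

Lemma hw_N0 : v *m N0 = 0.
Proof.
have [_ vU _] := hv; rewrite mulmx_sumr; under eq_bigr do rewrite vU.
exact: (sum_const0 j).
Qed.

Lemma hw_M0 : v *m M0 = v + \sum_(x | x != 0) j x ^+ m *: (v *m W *m U x).
Proof.
rewrite mulmx_sumr (bigD1 0) //= L0 mulmx1 sum_nz_inv; congr (_ + _).
by apply: eq_bigr => x x0; rewrite hw_L.
Qed.

End HighestWeight.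

(** * Representations with nonzero unipotent sum *)

Section Steinberg.

Variables (F : finFieldType) (K : fieldType) (j : {rmorphism F -> K}) (n : nat).
Variable rG : mx_representation K (SL2_group F) n.
Hypothesis irrG : mx_irreducible rG.
Local Notation rho := (rho rG).
Local Notation U := (upper rG).
Local Notation L := (lower rG).
Local Notation T := (torus rG).
Local Notation W := (weyl rG).
Local Notation N0 := (upper_sum rG).
Local Notation M0 := (lower_sum rG).
Local Notation highest_weight := (highest_weight j rG).

Hypothesis N0_neq0 : N0 != 0.

Lemma hw_WN0_neq0 m v : highest_weight m v -> v *m W *m N0 != 0.
Proof.
move=> hv; apply: contraNneq N0_neq0 => vWN0; apply/eqP.
by apply: (hw_ext irrG hv) => [|x]; rewrite ?(hw_N0 hv) // -mulmxA UN0.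
Qed.

(** The Weyl element inverts the weight t^m, and t^(q-2) = t^-1. *)
Lemma hw_WN0 m v : highest_weight m v ->
  highest_weight ((#|F| - 2) * m)%N (v *m W *m N0).
Proof.
move=> hv; split=> [|x|t t0]; first exact: hw_WN0_neq0 hv.
  by rewrite -mulmxA N0U.
have [_ _ vT] := hv.
rewrite -[LHS]mulmxA -TN0 // mulmxA -[v *m W *m T t]mulmxA WT // mulmxA.
rewrite vT ?invr_eq0 // -!scalemxAl exprM -(rmorphXn j (#|F| - 2) t); congr (j _ ^+ _ *: _).
apply: (mulfI (expf_neq0 2 t0)); rewrite -exprD subnKC ?expf_card.
  by field.
by rewrite (cardD1 0) (cardD1 1) !inE oner_eq0.
Qed.

Lemma M0E : M0 = W *m N0 *m W *m T (-1).
Proof.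
rewrite -M0W -!mulmxA [W *m (W *m _)]mulmxA WW TM ?oppr_eq0 ?oner_eq0 //.
by rewrite mulrNN mulr1 T1 mulmx1.
Qed.

Lemma T_inj k t (Z : 'M[K]_(k, n)) : t != 0 -> Z *m T t = 0 -> Z = 0.
Proof.
move=> t0 /(congr1 (mulmxr (T t^-1))) /=.
by rewrite mul0mx -mulmxA TM ?invr_eq0 // divff // T1 mulmx1.
Qed.

Variables (m : nat) (v : 'rV[K]_n).
Hypothesis hv : highest_weight m v.

(** Write M0 as a W-conjugate of N0. Since v W N0 is again a highest weight
    vector, v M0 N0 is nonzero; expanding v M0 over the Bruhat cells, it is
    v W N0 times the sum of the weight character over F^*, so this character is
    trivial. *)
Lemma weight_trivial t : t != 0 -> j t ^+ m = 1.
Proof.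
move=> t0; apply/eqP/negPn/negP => jt.
have sum0 : \sum_(x | x != 0) j x ^+ m = 0.
  by apply: (sum_char0 t0 _ jt) => x; rewrite rmorphM exprMn.
have m1_neq0 : -1 != 0 :> F by rewrite oppr_eq0 oner_eq0.
have /eqP := hw_WN0_neq0 (hw_WN0 hv); apply; apply: (T_inj m1_neq0).
rewrite -mulmxA -TN0 // mulmxA.
have -> : v *m W *m N0 *m W *m T (-1) = v *m M0 by rewrite M0E !mulmxA.
rewrite (hw_M0 hv) mulmxDl (hw_N0 hv) add0r mulmx_suml.
under eq_bigr do rewrite -scalemxAl -[_ *m N0]mulmxA UN0.
by rewrite -scaler_suml sum0 scale0r.
Qed.

Lemma hw_T t : t != 0 -> v *m T t = v.
Proof. by move=> t0; have [_ _ ->] := hv; rewrite ?weight_trivial ?scale1r. Qed.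

Lemma UT x t : t != 0 -> U x *m T t = T t *m U (x / t ^+ 2).
Proof. by move=> t0; rewrite TU // mulfVK // expf_eq0. Qed.

Lemma hw_WUT x t : t != 0 -> v *m W *m U x *m T t = v *m W *m U (x / t ^+ 2).
Proof.
move=> t0; rewrite -[LHS]mulmxA UT // mulmxA -[v *m W *m T t]mulmxA WT // mulmxA.
by rewrite hw_T ?invr_eq0.
Qed.

Lemma TN0_id t : t != 0 -> T t *m N0 = N0.
Proof.
move=> t0; apply/eqP; rewrite -subr_eq0; apply/eqP; apply: (hw_ext irrG hv) => [|x].
  by rewrite mulmxBr mulmxA hw_T // subrr.
by rewrite mulmxBr mulmxA hw_WUT // -![_ *m U _ *m N0]mulmxA !UN0 subrr.
Qed.

Lemma N0T_id t : t != 0 -> N0 *m T t = N0.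
Proof. by move=> t0; rewrite -TN0 // TN0_id. Qed.

Lemma torus_m1 : T (-1) = 1%:M.
Proof.
have m1_neq0 : -1 != 0 :> F by rewrite oppr_eq0 oner_eq0.
apply/eqP; rewrite -subr_eq0; apply/eqP; apply: (hw_ext irrG hv) => [|x].
  by rewrite mulmxBr hw_T // mulmx1 subrr.
by rewrite mulmxBr hw_WUT // mulmx1 sqrrN expr1n divr1 subrr.
Qed.

Lemma WW_id : W *m W = 1%:M. Proof. by rewrite WW torus_m1. Qed.

Lemma sum_WU : \sum_(x | x != 0) v *m W *m U x = v *m W *m N0 - v *m W.
Proof.
by rewrite mulmx_sumr [X in X - _](bigD1 0) //= U0 mulmx1 addrC addrK.
Qed.

(** The vector v + v W N0 is fixed by W as well as by the Borel subgroup. If it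
    were nonzero it would be a highest weight vector u with u W N0 = u N0 = 0. *)
Lemma hw_WN0E : v *m W *m N0 = - v.
Proof.
have vM0 : v *m W *m N0 *m W = v + v *m W *m N0 - v *m W.
  transitivity (v *m M0); first by rewrite M0E torus_m1 mulmx1 !mulmxA.
  rewrite (hw_M0 hv) -addrA -sum_WU; congr (_ + _); apply: eq_bigr => x x0.
  by rewrite weight_trivial // scale1r.
pose u := v + v *m W *m N0.
have uW : u *m W = u by rewrite mulmxDl vM0 addrC addrNK.
apply/eqP; rewrite -addr_eq0 addrC; apply/negPn/negP; rewrite -/u => u0.
have hu : highest_weight m u.
  have [_ vU vT] := hv; split=> // [x|t t0].
    by rewrite mulmxDl vU -[_ *m N0 *m _]mulmxA N0U.
  by rewrite mulmxDl hw_T // -[_ *m N0 *m _]mulmxA N0T_id // weight_trivial // scale1r.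
by have := hw_WN0_neq0 hu; rewrite uW (hw_N0 hu) eqxx.
Qed.

(** The sum runs over the conjugates of N0 by representatives of the cosets of
    the Borel subgroup; it is checked on v and on the v W U y. *)
Lemma relative_trace_N0 : N0 + \sum_x U (- x) *m W *m N0 *m W *m U x = 1%:M.
Proof.
have [_ vU _] := hv.
apply/eqP; rewrite -subr_eq0; apply/eqP; apply: (hw_ext irrG hv) => [|y].
  apply/eqP; rewrite mulmxBr subr_eq0 mulmx1 mulmxDr (hw_N0 hv) add0r mulmx_sumr.
  under eq_bigr do rewrite !mulmxA vU hw_WN0E.
  by rewrite -mulmx_sumr -/(upper_sum rG) !mulNmx hw_WN0E opprK.
apply/eqP; rewrite mulmxBr subr_eq0 mulmx1 mulmxDr -[X in X + _]mulmxA UN0 hw_WN0E.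
rewrite mulmx_sumr sum_opp (sum_shift _ (- y)).
(* After the change of variable x = y - z, the terms z <> 0 lie in the big cell
   and z = 0 gives v N0 = 0. *)
have tE z : v *m W *m U y *m (U (- - (z - y)) *m W *m N0 *m W *m U (- (z - y)))
    = if z == 0 then 0 else - (v *m W *m U (y - z)).
  have -> : - (z - y) = y - z by ring.
  have -> : - (y - z) = z - y by ring.
  rewrite !mulmxA -[v *m W *m U y *m _]mulmxA UD [y + _]addrC addrNK.
  rewrite -[v *m W *m U z]mulmxA WU mulmxA -[v *m L _ *m W *m W]mulmxA WW_id mulmx1.
  have [->|z0] := eqVneq z 0; first by rewrite oppr0 L0 mulmx1 (hw_N0 hv) !mul0mx.
  have z0' : - z^-1 != 0 by rewrite oppr_eq0 invr_eq0.
  rewrite -[- z]invrK invrN (hw_L hv z0') weight_trivial // scale1r.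
  by rewrite -[_ *m U _ *m N0]mulmxA UN0 hw_WN0E !mulNmx.
under eq_bigr do rewrite tE.
rewrite (bigD1 0) //= eqxx add0r.
under eq_bigr => z z0 do rewrite (negPf z0).
have : v *m W *m N0 = - v by exact: hw_WN0E.
rewrite mulmx_sumr sum_opp (sum_shift _ (- y)) (bigD1 0) //=.
have -> : - (0 - y) = y by ring.
move/eqP; rewrite eq_sym -subr_eq addrC => /eqP <-.
apply/eqP; rewrite addrC sumrN; congr (- _ - _).
by apply: eq_bigr => z _; rewrite opprB.
Qed.

End Steinberg.

(** * Invariant functionals when the unipotent sum is zero *)

Section Functional.

Variables (F : finFieldType) (K : fieldType) (j : {rmorphism F -> K}) (n : nat).
Variable rG : mx_representation K (SL2_group F) n.
Hypothesis irrG : mx_irreducible rG.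
Hypothesis q_gt3 : (3 < #|F|)%N.
Local Notation rho := (rho rG).
Local Notation U := (upper rG).
Local Notation L := (lower rG).
Local Notation T := (torus rG).
Local Notation W := (weyl rG).
Local Notation N0 := (upper_sum rG).
Local Notation N1 := (upper_moment j rG).
Local Notation M0 := (lower_sum rG).

Variable f : {scalar 'M[K]_n}.
Hypothesis fU : forall y X, f (U y *m X) = f (X *m U y).
Hypothesis f1 : f 1%:M = 0.
Hypothesis f_ss : forall a b c d, a * d - b * c = 1 ->
  a + d != 2 -> a + d != -2 -> f (rho a b c d) = 0.

(** The value of f at any element outside the Borel subgroup with trace tr and
    lower left entry c, see [phi_class]; (tr, -1/c; c, 0) is one of them. *)
Definition phi (tr c : F) : K := f (rho tr (- c^-1) c 0).

Lemma phi_class a b c d : a * d - b * c = 1 -> c != 0 ->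
  f (rho a b c d) = phi (a + d) c.
Proof.
move=> D c0; rewrite /phi !bruhat //; last by field.
by rewrite -!fU !mulmxA !UD !mul0r !add0r -mulrDl [d + a]addrC.
Qed.

Lemma phi_eq0 tr c : c != 0 -> tr != 2 -> tr != -2 -> phi tr c = 0.
Proof.
by move=> c0 t2 t2'; apply: f_ss; rewrite ?addr0 // ; field.
Qed.

Lemma phiU x c : c != 0 -> phi (x * c) c = f (U x *m T c^-1 *m W).
Proof.
move=> c0; rewrite /phi bruhat //; last by field.
by rewrite mulfK // mul0r U0 mulmx1.
Qed.

Lemma sum_phi (h : F -> K) c : c != 0 ->
  \sum_t h t * phi t c = \sum_x h (x * c) * f (U x *m T c^-1 *m W).
Proof.
by move=> c0; rewrite (sum_scale _ c0); apply: eq_bigr => x _; rewrite phiU.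
Qed.

Lemma sum_phi_even (h : F -> K) c : 2 = 0 :> F -> c != 0 ->
  \sum_t h t * phi t c = h 0 * phi 0 c.
Proof.
move=> F2 c0; rewrite (bigD1 0) //= big1 ?addr0 // => t t0.
by rewrite phi_eq0 ?mulr0 // F2 ?oppr0.
Qed.

Section Odd.

Hypothesis two_neq0 : 2 != 0 :> F.

Lemma two_neqN2 : 2 != - 2 :> F.
Proof.
by rewrite -subr_eq0 opprK (_ : 2 + 2 = 2 * 2) ?mulf_neq0 //; ring.
Qed.

Lemma sum_phi_odd (h : F -> K) c : c != 0 ->
  \sum_t h t * phi t c = h 2 * phi 2 c + h (-2) * phi (-2) c.
Proof.
move=> c0; rewrite (bigD1 2) //= (bigD1 (-2)) /=; last by rewrite eq_sym two_neqN2.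
by rewrite big1 ?addr0 // => t /andP[t2 t2']; rewrite phi_eq0 ?mulr0.
Qed.

Lemma two_neq0K : 2 != 0 :> K.
Proof. by rewrite -(rmorph_nat j) fmorph_eq0. Qed.

End Odd.

Section NoSum.

Hypothesis N00 : N0 = 0.
Variables (m : nat) (v : 'rV[K]_n).
Hypothesis hv : highest_weight j rG m v.

Lemma W_inj k (Z : 'M[K]_(k, n)) : Z *m W = 0 -> Z = 0.
Proof.
move=> ZW; rewrite -[Z]mulmx1 -(T1 rG) (_ : 1 = -1 * -1 :> F); last by ring.
by rewrite -TM ?oppr_eq0 ?oner_eq0 // -!WW !mulmxA ZW !mul0mx.
Qed.

Lemma M00 : M0 = 0.
Proof. by apply: W_inj; rewrite M0W N00 mulmx0. Qed.

Lemma f_M0 A : \sum_y f (A *m L y) = 0.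
Proof. by rewrite -linear_sum -mulmx_sumr -/(lower_sum rG) M00 mulmx0 linear0. Qed.

Lemma sum_phi0 c : c != 0 -> \sum_t phi t c = 0.
Proof.
move=> c0; under eq_bigr do rewrite -[phi _ _]mul1r.
rewrite sum_phi //; under eq_bigr do rewrite mul1r.
by rewrite -linear_sum -!mulmx_suml -/(upper_sum rG) N00 !mul0mx linear0.
Qed.

Lemma hw_N1 : v *m N1 = 0.
Proof.
have [_ vU _] := hv; rewrite mulmx_sumr.
under eq_bigr do rewrite -scalemxAr vU -[j _]expr1.
by rewrite -scaler_suml sum_expf0 ?scale0r // -subn1 ltn_subRL ltnW.
Qed.

Lemma UN1_id x : U x *m N1 = N1.
Proof. by rewrite UN1 N00 scaler0 subr0. Qed.

(** When N0 = 0, N1 absorbs the U x, so it has rank at most one. *)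
Lemma TN1 t : t != 0 -> T t *m N1 = j t^-1 ^+ m *: N1.
Proof.
move=> t0; have t20 : t ^+ 2 != 0 by rewrite expf_eq0.
have [_ vU vT] := hv.
apply/eqP; rewrite -subr_eq0; apply/eqP; apply: (hw_ext irrG hv) => [|x].
  by rewrite mulmxBr mulmxA vT // -scalemxAl -scalemxAr hw_N1 !scaler0 subr0.
rewrite mulmxBr -scalemxAr -[v *m W *m U x *m N1]mulmxA UN1_id.
rewrite -(mulfVK t20 x) -[_ *m (T t *m _)]mulmxA [U _ *m _]mulmxA -TU //.
rewrite -!mulmxA UN1_id mulmxA mulmxA -[v *m W *m T t]mulmxA WT // mulmxA vT ?invr_eq0 //.
by rewrite -!scalemxAl -!mulmxA subrr.
Qed.

Section Odd.

Hypothesis two_neq0 : 2 != 0 :> F.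

Lemma phiN2 c : c != 0 -> phi (-2) c = - phi 2 c.
Proof.
move=> c0; have := sum_phi0 c0; under eq_bigr do rewrite -[phi _ _]mul1r.
rewrite (sum_phi_odd two_neq0 (fun=> 1)) // !mul1r => /eqP.
by rewrite addrC addr_eq0 => /eqP.
Qed.

Definition psi (c : F) : K := j c^-1 * j c ^+ m.

(** First moment of phi in the trace: the factor 4 comes from
    2 * phi 2 c - 2 * phi (-2) c. *)
Lemma phi2_N1 c : c != 0 -> 4 * phi 2 c = psi c * f (N1 *m W).
Proof.
move=> c0; transitivity (\sum_t j t * phi t c).
  by rewrite sum_phi_odd // phiN2 // rmorphN rmorph_nat; ring.
rewrite sum_phi //; under eq_bigr => x _ do
  rewrite rmorphM [j x * _]mulrC -mulrA -linearZ !scalemxAl.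
rewrite -mulr_sumr -linear_sum -!mulmx_suml -/(upper_moment j rG) N1T ?invr_eq0 // TN1 ?invr_eq0 //.
rewrite invrK -!scalemxAl scalerA linearZ /psi mulrA; congr (_ * _).
by rewrite fmorphV; field; rewrite fmorph_eq0.
Qed.

Lemma psi1 : psi 1 = 1.
Proof. by rewrite /psi invr1 rmorph1 expr1n mul1r. Qed.

Lemma psiM x y : psi (x * y) = psi x * psi y.
Proof. by rewrite /psi invfM !rmorphM exprMn; ring. Qed.

Lemma psi0 : psi 0 = 0.
Proof. by rewrite /psi invr0 rmorph0 mul0r. Qed.

Lemma phi2_psi c : c != 0 -> phi 2 c = psi c * phi 2 1.
Proof.
move=> c0; have four0 : 4 != 0 :> K.
  by rewrite (_ : 4 = 2 * 2) ?mulf_neq0 ?two_neq0K //; ring.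
apply: (mulfI four0).
by rewrite phi2_N1 // mulrCA phi2_N1 ?oner_eq0 // psi1 mul1r.
Qed.

(** In the coset of U b by the lower unipotents only y = 0 and y = -4/b give
    traces 2 and -2. *)
Lemma f_U_psi b : b != 0 -> f (U b) = psi (- 4 / b) * phi 2 1.
Proof.
move=> b0; have four0 : 4 != 0 :> F.
  by rewrite (_ : 4 = 2 * 2) ?mulf_neq0 //; ring.
have y0 : - 4 / b != 0 by rewrite mulf_neq0 ?invr_eq0 ?oppr_eq0.
have AL y : U b *m L y = rho (1 + b * y) b y 1 by apply: rhoM; ring.
have := f_M0 (U b); rewrite (bigD1 0) //= L0 mulmx1 (bigD1 (- 4 / b)) //= big1.
  rewrite addr0 AL phi_class //; last by field.
  rewrite (_ : 1 + _ + 1 = -2); last by field.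
  by rewrite phiN2 // phi2_psi // => /eqP; rewrite subr_eq0 => /eqP.
move=> y /andP[y1 y2]; rewrite AL phi_class //; last by field.
rewrite phi_eq0 //.
  rewrite -subr_eq0 (_ : 1 + b * y + 1 - 2 = b * y); last by ring.
  by rewrite mulf_neq0.
rewrite -subr_eq0 (_ : 1 + b * y + 1 - - 2 = b * (y - - 4 / b)); last by field.
by rewrite mulf_neq0 // subr_eq0.
Qed.

Lemma psi_sum : phi 2 1 != 0 -> \sum_x psi x = 0.
Proof.
move=> nz; have four0 : - 4 != 0 :> F.
  by rewrite oppr_eq0 (_ : 4 = 2 * 2) ?mulf_neq0 //; ring.
rewrite (bigD1 0) //= psi0 add0r (sum_nz_mul _ four0) sum_nz_inv.
apply: (mulIf nz); rewrite mul0r mulr_suml.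
transitivity (f N0); last by rewrite N00 linear0.
rewrite linear_sum [RHS](bigD1 0) //= U0 f1 add0r.
by apply: eq_bigr => b b0; rewrite f_U_psi // [b^-1 * _]mulrC.
Qed.

(** The coset by the lower unipotents of a non-diagonal matrix of trace 2 contains
    one element of trace -2. The matrix is chosen so that their lower left
    entries are 1 and x^2. *)
Lemma psi_sq x : phi 2 1 != 0 -> x != 0 -> psi x ^+ 2 = 1.
Proof.
move=> nz x0; have [->|x1] := eqVneq x 1; first by rewrite psi1 expr1n.
have x1' : 1 - x != 0 by rewrite subr_eq0 eq_sym.
(* so that (s - 2) / s = x *)
pose s := 2 / (1 - x).
have s0 : s != 0 by rewrite mulf_neq0 ?invr_eq0.
have x20 : x ^+ 2 != 0 by rewrite expf_eq0.
have four0 : 4 != 0 :> F.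
  by rewrite (_ : 4 = 2 * 2) ?mulf_neq0 //; ring.
pose A := rho (1 + s) (- s ^+ 2) 1 (1 - s).
have AL y : A *m L y = rho (1 + s - s ^+ 2 * y) (- s ^+ 2) (1 + (1 - s) * y) (1 - s).
  by apply: rhoM; ring.
have y0 : 4 / s ^+ 2 != 0 by rewrite mulf_neq0 ?invr_eq0 ?expf_eq0.
have cE : 1 + (1 - s) * (4 / s ^+ 2) = x ^+ 2.
  by rewrite /s; field; rewrite x1' four0.
have := f_M0 A; rewrite (bigD1 0) //= L0 mulmx1 (bigD1 (4 / s ^+ 2)) //= big1.
  rewrite addr0 AL cE !phi_class ?oner_eq0 //; try by ring.
    rewrite (_ : 1 + s + (1 - s) = 2); last by ring.
    rewrite (_ : _ + (1 - s) = -2); last by field.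
    rewrite phiN2 // (phi2_psi x20) expr2 psiM -expr2.
    rewrite -{1}[phi 2 1]mul1r -mulrBl => /eqP; rewrite mulf_eq0 (negPf nz) orbF.
    by rewrite subr_eq0 => /eqP.
  by rewrite -cE; field.
move=> y /andP[y1 y2]; rewrite AL f_ss //; first by ring.
  rewrite -subr_eq0 (_ : _ - _ = - s ^+ 2 * y); last by ring.
  by rewrite mulf_neq0 ?oppr_eq0 ?expf_eq0.
rewrite -subr_eq0 (_ : _ - _ = - s ^+ 2 * (y - 4 / s ^+ 2)); last by field.
by rewrite mulf_neq0 ?oppr_eq0 ?expf_eq0 // subr_eq0.
Qed.

(** This is v *m M0 = 0 expanded over the Bruhat cells, since the weight
    of v is x psi(x). *)
Lemma hw_W_psi : v = - \sum_x (j x * psi x) *: (v *m W *m U x).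
Proof.
have := hw_M0 hv; rewrite M00 mulmx0 => /esym/eqP; rewrite addr_eq0 => /eqP {1}->.
congr (- _); rewrite [RHS](bigD1 0) //= psi0 mulr0 scale0r add0r.
apply: eq_bigr => x x0; congr (_ *: _); rewrite /psi mulrA fmorphV mulfV ?mul1r //.
by rewrite fmorph_eq0.
Qed.

(** Apply the sum of the psi y *: U y to [hw_W_psi]. The left-hand side dies
    because v is fixed and psi has sum zero; the right-hand side is a Jacobi sum
    times v W N1. *)
Lemma phi2_1_eq0 : phi 2 1 = 0.
Proof.
apply/eqP/negPn/negP=> nz.
have sq x := @psi_sq x nz; have sum0 := psi_sum nz.
have [_ vU _] := hv.
have vPsi : v *m \sum_y psi y *: U y = 0.
  rewrite mulmx_sumr; under eq_bigr do rewrite -scalemxAr vU.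
  by rewrite -scaler_suml sum0 scale0r.
have vWN1 : v *m W *m N1 = 0.
  apply: (scalerI (jacobi_neq0 j psi0 psiM sq sum0)); rewrite scaler0.
  rewrite mulmx_sumr; under eq_bigr do rewrite -scalemxAr.
  rewrite -(jacobi_convolution j psiM sq (fun z => v *m W *m U z)) 1?ltnW //.
  move: vPsi; rewrite {1}hw_W_psi mulNmx mulmx_suml => /eqP; rewrite oppr_eq0 => /eqP vPsi.
  apply: etrans vPsi; apply: eq_bigr => x _; rewrite mulmx_sumr; apply: eq_bigr => y _.
  by rewrite -scalemxAl -scalemxAr scalerA -UD mulmxA.
have N10 : N1 = 0.
  by apply: (hw_ext irrG hv) => [|x]; rewrite ?hw_N1 // -mulmxA UN1_id.
have := phi2_N1 (oner_neq0 F); rewrite N10 mul0mx linear0 mulr0 => /eqP.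
have four0 : 4 != 0 :> K.
  by rewrite (_ : 4 = 2 * 2) ?mulf_neq0 ?two_neq0K //; ring.
by rewrite mulf_eq0 (negPf nz) orbF (negPf four0).
Qed.

End Odd.

Lemma phi_eq0_noSum tr c : c != 0 -> phi tr c = 0.
Proof.
move=> c0; have [two0|two0] := eqVneq (2 : F) 0.
  have [->|t0] := eqVneq tr 0; last by rewrite phi_eq0 // two0 ?oppr0.
  have := sum_phi0 c0; under eq_bigr do rewrite -[phi _ _]mul1r.
  by rewrite (sum_phi_even (fun=> 1)) // mul1r.
have ph2 : phi 2 c = 0 by rewrite phi2_psi // phi2_1_eq0 ?mulr0.
have [->|t2] := eqVneq tr 2; first exact: ph2.
have [->|t2'] := eqVneq tr (-2); first by rewrite phiN2 // ph2 oppr0.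
by rewrite phi_eq0.
Qed.

(** In a coset of an upper triangular matrix by the lower unipotents, all other
    elements are outside the Borel subgroup. *)
Lemma f_eq0_noSum a b c d : a * d - b * c = 1 -> f (rho a b c d) = 0.
Proof.
move=> D; have [c0|c0] := eqVneq c 0; last by rewrite phi_class // phi_eq0_noSum.
have := f_M0 (rho a b c d); rewrite (bigD1 0) //= L0 mulmx1 big1 ?addr0 //.
rewrite c0 in D * => y y0.
have d0 : d != 0.
  by apply: contra_eq_neq D => ->; rewrite !mulr0 subr0 eq_sym oner_eq0.
have -> : rho a b 0 d *m L y = rho (a + b * y) b (d * y) d by apply: rhoM => //; ring.
by rewrite phi_class ?phi_eq0_noSum ?mulf_neq0 // -D; ring.
Qed.

End NoSum.

End Functional.

(** * Invariant functionals when the unipotent sum is nonzero *)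

Section SteinbergFunctional.

Variables (F : finFieldType) (K : fieldType) (j : {rmorphism F -> K}) (n : nat).
Variable rG : mx_representation K (SL2_group F) n.
Hypothesis irrG : mx_irreducible rG.
Hypothesis q_gt3 : (3 < #|F|)%N.
Local Notation rho := (rho rG).
Local Notation U := (upper rG).
Local Notation T := (torus rG).
Local Notation W := (weyl rG).
Local Notation N0 := (upper_sum rG).

Variable f : {scalar 'M[K]_n}.
Hypothesis fU : forall y X, f (U y *m X) = f (X *m U y).
Hypothesis f1 : f 1%:M = 0.
Hypothesis f_ss : forall a b c d, a * d - b * c = 1 ->
  a + d != 2 -> a + d != -2 -> f (rho a b c d) = 0.
Local Notation phi := (phi rG f).

Hypothesis N0_neq0 : N0 != 0.
Variables (m : nat) (v : 'rV[K]_n).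
Hypothesis hv : highest_weight j rG m v.

Let TN0_id := TN0_id irrG N0_neq0 hv.

(** By invariance of f, its value at g N0 h^-1 when g and h represent two points of
    the affine line whose difference is z; here W is its own inverse. *)
Definition kappa z := f (U z *m W *m N0 *m W).
Definition mu k := \sum_x j x ^+ k * kappa x.

Lemma rho_WN0 a b c d : a * d - b * c = 1 ->
  rho a b c d *m W *m N0 = if d == 0 then N0 else U (b / d) *m W *m N0.
Proof.
move=> D; have -> : rho a b c d *m W = rho b (- a) d (- c) by apply: rhoM => //; ring.
have [d0|d0] := eqVneq d 0.
  rewrite d0; move: D; rewrite d0 mulr0 sub0r -mulrN => D; rewrite borel //.
  rewrite -mulmxA UN0 TN0_id //.
  by apply: contra_eq_neq D => ->; rewrite mul0r eq_sym oner_eq0.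
rewrite bruhat //; last by rewrite -D; ring.
rewrite -[_ *m U (- c / d) *m _]mulmxA UN0 -[U _ *m _ *m W]mulmxA.
by rewrite -WT // -!mulmxA TN0_id.
Qed.

Lemma f_relative_trace a b c d : a * d - b * c = 1 ->
  f (rho a b c d) = f (rho a b c d *m N0) + \sum_x
    (let s := d - x * c in
     if s == 0 then f (N0 *m W) else kappa ((b + x * (d - a) - x ^+ 2 * c) / s)).
Proof.
move=> D; rewrite -{1}[rho a b c d]mulmx1 -(relative_trace_N0 irrG N0_neq0 hv).
rewrite mulmxDr linearD; congr (_ + _).
rewrite mulmx_sumr linear_sum.
apply: eq_bigr => x _ /=; rewrite !mulmxA -fU !mulmxA.
rewrite upper_conj //.
rewrite rho_WN0; last by rewrite -D; ring.
by case: ifP.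
Qed.

Lemma f_N0 : f N0 = 0.
Proof.
have D : 1 * 1 - 0 * 0 = 1 :> F by ring.
have := f_relative_trace D; rewrite rho1 f1 mul1mx => /esym.
rewrite (eq_bigr (fun=> kappa 0)) ?(sum_const0K j) ?addr0 // => x _ /=.
rewrite mulr0 subr0 oner_eq0 subrr mulr0; congr kappa; ring.
Qed.

Lemma borel_N0 a b d : a * d = 1 -> rho a b 0 d *m N0 = N0.
Proof.
move=> D; rewrite borel // -mulmxA UN0 TN0_id //.
by apply: contra_eq_neq D => ->; rewrite mul0r eq_sym oner_eq0.
Qed.

Lemma f_borel a b d : a * d = 1 ->
  f (rho a b 0 d) = \sum_x kappa ((b + x * (d - a)) / d).
Proof.
move=> D; have d0 : d != 0.
  by apply: contra_eq_neq D => ->; rewrite mulr0 eq_sym oner_eq0.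
rewrite f_relative_trace ?mulr0 ?subr0 // borel_N0 // f_N0 add0r.
by apply: eq_bigr => x _ /=; rewrite !mulr0 !subr0 (negPf d0).
Qed.

(** Evaluate [f_borel] at diag(t, 1/t) with t^2 <> 1, which has trace other
    than 2 and -2. *)
Lemma sum_kappa : \sum_x kappa x = 0.
Proof.
have [t t0 t2] : exists2 t : F, t != 0 & t ^+ 2 != 1.
  by apply: exists_expf_neq1; rewrite -subn1 ltn_subRL.
have tr e : e ^+ 2 = 1 -> t + t^-1 != 2 * e.
  move=> e2; apply: contraNneq t2 => tr.
  have : (t - e) ^+ 2 = 0.
    rewrite sqrrB e2; transitivity (t * ((t + t^-1) - 2 * e)); first by field.
    by rewrite tr subrr mulr0.
  by move=> /eqP; rewrite expf_eq0 /= subr_eq0 => /eqP ->; rewrite e2.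
have D : t * t^-1 = 1 by rewrite divff.
have d0 : (t^-1 - t) / t^-1 != 0.
  rewrite mulf_neq0 ?invr_eq0 // subr_eq0; apply: contraNneq t2 => ti.
  by rewrite expr2 -{1}ti mulVf.
rewrite (sum_scale _ d0).
transitivity (f (rho t 0 0 t^-1)).
  by rewrite f_borel //; apply: eq_bigr => x _; rewrite add0r mulrA.
apply: f_ss; first by rewrite divff // mulr0 subr0.
  by have := tr 1; rewrite expr1n mulr1; apply.
by have := tr (-1); rewrite sqrrN expr1n mulrN1; apply.
Qed.

Lemma f_borel_eq0 a b d : a * d = 1 -> f (rho a b 0 d) = 0.
Proof.
move=> D; have d0 : d != 0.
  by apply: contra_eq_neq D => ->; rewrite mulr0 eq_sym oner_eq0.
rewrite f_borel //; have [->|da] := eqVneq d a.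
  rewrite (eq_bigr (fun=> kappa (b / a))) ?(sum_const0K j) // => x _.
  by rewrite subrr mulr0 addr0.
have d1 : (d - a) / d != 0 by rewrite mulf_neq0 ?invr_eq0 // subr_eq0.
transitivity (\sum_x kappa x); last exact: sum_kappa.
rewrite [RHS](sum_scale _ d1) [RHS](sum_shift _ (b / (d - a))).
apply: eq_bigr => x _; congr kappa; field.
by rewrite d0 subr_eq0.
Qed.

(** The constant collects the two terms of the sum over the projective line in
    which a point at infinity is involved. *)
Lemma phiE : exists C, forall t c, c != 0 ->
  phi t c = C + \sum_(s | s != 0) kappa ((t - s - s^-1) / c).
Proof.
exists (f (W *m N0) + f (N0 *m W)) => t c c0.
have D : t * 0 - - c^-1 * c = 1 by field.
rewrite /phi f_relative_trace //.
have -> : f (rho t (- c^-1) c 0 *m N0) = f (W *m N0).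
  rewrite bruhat // -!mulmxA UN0 [T _ *m _]mulmxA -WT // fU -!mulmxA N0U TN0_id //.
have ci : - c^-1 != 0 by rewrite oppr_eq0 invr_eq0.
rewrite -addrA (sum_scale _ ci) (bigD1 0) //=; congr (_ + (_ + _)).
  by rewrite !mul0r subr0 eqxx.
apply: eq_bigr => s s0.
have -> : 0 - s * - c^-1 * c = s by field.
by rewrite (negPf s0); congr kappa; field; rewrite s0 c0.
Qed.

Lemma moment_phi k c : (k < #|F|.-1)%N -> c != 0 ->
  \sum_t j t ^+ k * phi t c =
  \sum_(s | s != 0) \sum_x j (x * c + (s + s^-1)) ^+ k * kappa x.
Proof.
move=> kq c0; have [C phiE] := phiE.
under eq_bigr do rewrite phiE // mulrDr mulr_sumr.
rewrite big_split /= -mulr_suml sum_expf0 // mul0r add0r exchange_big.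
apply: eq_bigr => s s0; rewrite (sum_shift _ (s + s^-1)) (sum_scale _ c0).
by apply: eq_bigr => x _; congr (_ * kappa _); field; rewrite ?s0 ?c0.
Qed.

Lemma sum_trace : \sum_(s : F | s != 0) j (s + s^-1) = 0.
Proof.
under eq_bigr do rewrite rmorphD.
rewrite big_split /= -(sum_nz_inv j) (_ : \sum_(s | _) _ = 0) ?addr0 //.
under eq_bigr do rewrite -[j _]expr1.
by rewrite sum_nz_expf0 //= -subn1 ltn_subRL ltnW.
Qed.

Lemma sum_trace_sq : \sum_(s : F | s != 0) j (s + s^-1) ^+ 2 = -2.
Proof.
transitivity (\sum_(s : F | s != 0) (j s ^+ 2 + j s^-1 ^+ 2 + 2)).
  apply: eq_bigr => s s0; rewrite rmorphD fmorphV.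
  by field; rewrite fmorph_eq0.
rewrite !big_split /= -(sum_nz_inv (fun s => j s ^+ 2)) (sum_nz_constK j).
rewrite sum_nz_expf0; first by rewrite !add0r; ring.
by rewrite /= -subn1 ltn_subRL.
Qed.

Lemma mu0 : mu 0 = 0.
Proof. by rewrite /mu -[RHS]sum_kappa; under eq_bigr do rewrite mul1r. Qed.

Lemma moment0 c : c != 0 -> \sum_t phi t c = 0.
Proof.
move=> c0; have := @moment_phi 0 c; under eq_bigr do rewrite mul1r.
move=> -> //; last by rewrite -subn1 ltn_subRL ltnW // ltnW.
rewrite big1 // => s s0; rewrite -[RHS]sum_kappa.
by apply: eq_bigr => x _; rewrite mul1r.
Qed.

Lemma moment1 c : c != 0 -> \sum_t j t * phi t c = - (j c * mu 1).
Proof.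
move=> c0; have := @moment_phi 1 c; under eq_bigr do rewrite expr1.
move=> -> //; last by rewrite -subn1 ltn_subRL ltnW.
rewrite -(sum_nz_constK j (j c * mu 1)).
transitivity (\sum_(s : F | s != 0) (j c * mu 1 + j (s + s^-1) * mu 0)).
  apply: eq_bigr => s s0; rewrite /mu !mulr_sumr -big_split; apply: eq_bigr => x _ /=.
  by rewrite !rmorphD rmorphM; ring.
by rewrite mu0; apply: eq_bigr => s s0; rewrite mulr0 addr0.
Qed.

Lemma moment3 c : (4 < #|F|)%N -> c != 0 ->
  \sum_t j t ^+ 3 * phi t c = - (j c ^+ 3 * mu 3) - 6 * (j c * mu 1).
Proof.
move=> q4 c0; rewrite moment_phi //; last by rewrite -subn1 ltn_subRL.
transitivity (\sum_(s : F | s != 0) (j c ^+ 3 * mu 3 +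
   j (s + s^-1) * (3 * j c ^+ 2 * mu 2) + j (s + s^-1) ^+ 2 * (3 * j c * mu 1))).
  apply: eq_bigr => s s0; rewrite -[RHS]addr0 -[in RHS](mulr0 (j (s + s^-1) ^+ 3)).
  rewrite -[in X in _ = _ + X]mu0 /mu !mulr_sumr -!big_split /=; apply: eq_bigr => x _ /=.
  by rewrite !rmorphD rmorphM; ring.
rewrite !big_split /= -!mulr_suml sum_trace sum_trace_sq.
by rewrite (sum_nz_constK j); ring.
Qed.

(** Eliminating phi from the first and third moments leaves
    c^2 mu 3 = -2 mu 1 for all nonzero c, hence mu 3 = mu 1 = 0 as c^2 takes a
    value other than 1. *)
Lemma phi2_odd_eq0 c : 2 != 0 :> F -> c != 0 -> phi 2 c = 0 /\ phi (-2) c = 0.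
Proof.
move=> two0 c0; have two0K := two_neq0K j two0.
have q4 : (4 < #|F|)%N.
  rewrite ltn_neqAle q_gt3 andbT; apply: contra_neq (mulf_neq0 two0K two0K) => q4.
  by rewrite -(natr_card j) -q4; ring.
have phiN c' : c' != 0 -> phi (-2) c' = - phi 2 c'.
  move=> c0'; have := moment0 c0'; under eq_bigr do rewrite -[phi _ _]mul1r.
  rewrite (sum_phi_odd f_ss two0 (fun=> 1)) // !mul1r => /eqP.
  by rewrite addrC addr_eq0 => /eqP.
have mom1 c' : c' != 0 -> 4 * phi 2 c' = - (j c' * mu 1).
  move=> c0'; rewrite -moment1 // (sum_phi_odd f_ss two0) // phiN //.
  by rewrite rmorphN rmorph_nat; ring.
have mom3 c' : c' != 0 -> j c' ^+ 2 * mu 3 = - 2 * mu 1.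
  move=> c0'; have := moment3 q4 c0'.
  rewrite (sum_phi_odd f_ss two0 (fun t => j t ^+ 3)) // phiN // rmorphN rmorph_nat.
  have -> : 2 ^+ 3 * phi 2 c' + (- 2) ^+ 3 * - phi 2 c' = 4 * (4 * phi 2 c') by ring.
  rewrite mom1 // => e.
  have jc : j c' != 0 by rewrite fmorph_eq0.
  apply: (mulfI jc).
  transitivity (- (- (j c' ^+ 3 * mu 3) - 6 * (j c' * mu 1)) - 6 * (j c' * mu 1)).
    by ring.
  by rewrite -e; ring.
have [s s0 s2] : exists2 s : F, s != 0 & s ^+ 2 != 1.
  by apply: exists_expf_neq1; rewrite -subn1 ltn_subRL.
have mu3 : mu 3 = 0.
  apply/eqP; have : (j s ^+ 2 - 1) * mu 3 = 0.
    have := mom3 1 (oner_neq0 F); rewrite rmorph1 expr1n mul1r => m1.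
    by rewrite mulrBl mom3 // mul1r m1 subrr.
  by move/eqP; rewrite mulf_eq0 subr_eq0 -rmorphXn fmorph_eq1 (negPf s2).
have mu1 : mu 1 = 0.
  have := mom3 s s0; rewrite mu3 mulr0 => /esym/eqP.
  by rewrite mulf_eq0 oppr_eq0 (negPf two0K) => /eqP.
suff p2 : phi 2 c = 0 by rewrite phiN // p2 oppr0.
have four0 : 4 != 0 :> K by rewrite (_ : 4 = 2 * 2) ?mulf_neq0 //; ring.
by apply: (mulfI four0); rewrite mom1 // mu1 !mulr0 oppr0.
Qed.

Lemma f_eq0_Steinberg a b c d : a * d - b * c = 1 -> f (rho a b c d) = 0.
Proof.
move=> D; have [c0|c0] := eqVneq c 0.
  by move: D; rewrite c0 mulr0 subr0; exact: f_borel_eq0.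
rewrite phi_class //; set t := a + d.
have [two0|two0] := eqVneq (2 : F) 0.
  have [->|t0] := eqVneq t 0; last by rewrite (phi_eq0 f_ss) // two0 ?oppr0.
  have := moment0 c0; under eq_bigr do rewrite -[phi _ _]mul1r.
  by rewrite (sum_phi_even f_ss (fun=> 1)) // mul1r.
have [p2 pN2] := phi2_odd_eq0 two0 c0.
have [->|t2] := eqVneq t 2; first exact: p2.
have [->|t2'] := eqVneq t (-2); first exact: pN2.
by rewrite (phi_eq0 f_ss).
Qed.

End SteinbergFunctional.

(** * Embedding the finite field; elements of order prime to p *)

Section Embedding.

Variables (p : nat) (F : finFieldType) (K : closedFieldType).
Variables (pF : p \in [pchar F]) (iota : {rmorphism 'F_p -> K}).

Local Notation E := (pPrimeCharType pF).
Local Notation incl := (in_alg E).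

Lemma polynomial_generator :
  exists g : E, forall x : E, exists P : {poly 'F_p}, (map_poly incl P).[g] == x.
Proof.
have /cyclicP[u uE] := field_unit_group_cyclic [group of [set: {unit F}]].
exists (val u) => x; have [->|x0] := eqVneq x 0.
  by exists 0; rewrite rmorph0 horner0.
have xu : (x : F) \is a GRing.unit by rewrite unitfE.
have : FinRing.unit F xu \in <[u]>%g by rewrite -uE inE.
case/cycleP=> k xk; exists ('X^k); rewrite map_polyXn hornerXn.
have -> : x = val (FinRing.unit F xu) by [].
by rewrite xk FinRing.val_unitX.
Qed.

(** Write F as F_p(g) with g a generator of F^*, and send g to a root in K of
    its minimal polynomial. *)
Lemma finField_embedding : exists j : {rmorphism F -> K}, True.
Proof.
have [g gen] := polynomial_generator.
have /polyOver1P[mp mpE] := minPolyOver 1%AS g.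
have [z z0] : exists z, root (map_poly iota mp) z.
  apply/closed_rootP; rewrite size_map_poly -(size_map_poly incl) -mpE.
  by rewrite size_minPoly.
have wd (P : {poly 'F_p}) : (map_poly incl P).[g] = 0 -> (map_poly iota P).[z] = 0.
  move=> /rootP Pg; apply/rootP; have /dvdpP[Q ->] : mp %| P.
    by rewrite -(dvdp_map incl) -mpE minPoly_dvdp //; apply/polyOver1P; exists P.
  by rewrite rmorphM rootM z0 orbT.
pose S x := xchoose (gen x); have SE x : (map_poly incl (S x)).[g] = x.
  exact/eqP/(xchooseP (gen x)).
pose e (x : F) : K := (map_poly iota (S x)).[z].
have eE (P : {poly 'F_p}) x : (map_poly incl P).[g] = x -> e x = (map_poly iota P).[z].
  move=> Px; apply/eqP; rewrite -subr_eq0 -hornerN -hornerD -rmorphN -rmorphD.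
  by apply/eqP/wd; rewrite rmorphB hornerD hornerN SE Px subrr.
have eB : zmod_morphism e.
  move=> x y; rewrite (eE (S x - S y)); last by rewrite rmorphB hornerD hornerN !SE.
  by rewrite rmorphB hornerD hornerN.
have eM : monoid_morphism e.
  split=> [|x y]; first by rewrite (eE 1) ?rmorph1 ?hornerC.
  rewrite (eE (S x * S y)); last by rewrite rmorphM hornerM !SE.
  by rewrite rmorphM hornerM.
pose eAdd := GRing.isZmodMorphism.Build F K e eB.
pose eMul := GRing.isMonoidMorphism.Build F K e eM.
by exists (HB.pack_for {rmorphism F -> K} e eAdd eMul).
Qed.

End Embedding.

Section Semisimple.

Variables (p : nat) (F : finFieldType).
Hypothesis pF : p \in [pchar F].

(** By Cayley-Hamilton N^2 = tr(N) N once the determinant vanishes. *)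
Lemma mx2_nilpotent (N : 'M[F]_2) k : N ^+ k = 0 -> \det N = 0 /\ \tr N = 0.
Proof.
move=> Nk; have dN : \det N = 0.
  apply/eqP; suff : \det N ^+ k == 0 by rewrite expf_eq0 => /andP[].
  have -> : \det N ^+ k = \det (N ^+ k).
    by elim: k {Nk} => [|k IHk]; rewrite ?det1 // !exprS IHk -det_mulmx.
  by rewrite Nk det0.
split=> //; have NN : N * N = \tr N *: N.
  apply/eqP; rewrite -subr_eq0; apply/eqP; move: dN; rewrite (mx2_eq N).
  move: (N 0 0) (N 0 1) (N 1 0) (N 1 1) => x y z w; rewrite det_mx2 tr_mx2 => D.
  rewrite -[_ * _]/(_ *m _) mul_mx2; apply/matrixP=> i l; rewrite !mxE.
  by case: ifP => _; case: ifP => _; first [by ring | by rewrite -[RHS]oppr0 -D; ring].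
have NX l : N ^+ l.+1 = \tr N ^+ l *: N.
  elim: l => [|l IHl]; first by rewrite expr0 scale1r.
  by rewrite exprS IHl -scalerAr NN scalerA -exprSr.
have : \tr N ^+ k *: N = 0 by rewrite -NX exprS Nk mulr0.
move/eqP; rewrite scaler_eq0 expf_eq0 => /orP[/andP[_ /eqP]|/eqP ->] //.
by rewrite raddf0.
Qed.

(** A power h of g has order p, so N = h - 1 is a nonzero nilpotent matrix
    commuting with g; hence g is a scalar plus a multiple of N, and its
    discriminant is zero. *)
Lemma trace_of_p_element (a b c d : F) : a * d - b * c = 1 ->
  (p %| #[sl2 a b c d]%g)%N -> (a + d) ^+ 2 = 4.
Proof.
move=> D pg; set g := sl2 a b c d in pg *.
have p_pr := pcharf_prime pF.
pose h := (g ^+ (#[g]%g %/ p))%g.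
have h1 : h != 1%g.
  rewrite -order_dvdn gtnNdvd //; last by rewrite ltn_Pdiv ?prime_gt1 // order_gt0.
  by rewrite divn_gt0 ?prime_gt0 // dvdn_leq.
have hp : (h ^+ p)%g = 1%g by rewrite -expgM divnK // expg_order.
pose A := mx2 a b c d.
have hA : val h = A ^+ (#[g]%g %/ p) by rewrite FinRing.val_unitX /A -(val_sl2 D).
pose N := val h - 1.
have N0 : N != 0 by rewrite subr_eq0; apply: contraNneq h1 => h1; apply/eqP/val_inj.
have [dN tN] : \det N = 0 /\ \tr N = 0.
  apply: (@mx2_nilpotent N p).
  have pM : p \in [pchar 'M[F]_2] by rewrite pchar_lalg.
  rewrite -(pFrobenius_autE pM) pFrobenius_autB_comm; last exact: commr1.
  by rewrite !pFrobenius_autE -FinRing.val_unitX hp expr1n subrr.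
have cAN : A *m N = N *m A.
  have : GRing.comm A N by rewrite /N hA; apply: commrB (commr1 _); apply: commrX.
  by [].
move: N0 dN tN cAN; rewrite (mx2_eq N).
move: (N 0 0) (N 0 1) (N 1 0) (N 1 1) => x y z w.
rewrite det_mx2 tr_mx2 !mul_mx2 => N0 dN /eqP; rewrite addr_eq0 => /eqP xE /matrixP cAN.
move: (cAN 0 0) (cAN 0 1) (cAN 1 0); rewrite !mxE /= {cAN} => e00 e01 e10.
subst x.
have eqI (u1 u2 w1 w2 : F) : u1 = u2 -> w1 - w2 = u1 - u2 -> w1 = w2.
  by move=> -> e; apply/eqP; rewrite -subr_eq0 e subrr.
have ey : (a - d) * y = - (2 * b * w) by apply: (eqI _ _ _ _ e01); ring.
have ez : (a - d) * z = - (2 * w * c) by apply: (eqI _ _ _ _ (esym e10)); ring.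
have ebc : b * z = y * c by apply: (eqI _ _ _ _ e00); ring.
have wE : w ^+ 2 = - (y * z) by apply: (eqI _ _ _ _ (esym dN)); ring.
suff disc : (a - d) ^+ 2 = - (4 * b * c).
  transitivity ((a - d) ^+ 2 + 4 * a * d); first by ring.
  by rewrite disc; transitivity (4 * (a * d - b * c)); [ring | rewrite D mulr1].
have [y0|y0] := eqVneq y 0.
  have z0 : z != 0.
    apply: contraNneq N0 => z0; move: wE; rewrite z0 mulr0 oppr0 => /eqP.
    rewrite expf_eq0 /= => /eqP ->; rewrite y0 oppr0; apply/eqP/matrixP=> i l.
    by rewrite !mxE; case: ifP; case: ifP.
  apply: (mulIf (expf_neq0 2 z0)); rewrite -exprMn ez.
  transitivity (4 * c ^+ 2 * w ^+ 2); first by ring.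
  by rewrite wE; transitivity (- (4 * c * z * (y * c))); [ring | rewrite -ebc; ring].
apply: (mulIf (expf_neq0 2 y0)); rewrite -exprMn ey.
transitivity (4 * b ^+ 2 * w ^+ 2); first by ring.
by rewrite wE; transitivity (- (4 * b * y * (b * z))); [ring | rewrite ebc; ring].
Qed.

Variables (K : fieldType) (pK : p \in [pchar K]) (n : nat).

Lemma semisimple_p' (gT : finGroupType) (G : {group gT})
    (rG : mx_representation K G n) g :
  g \in G -> ~~ (p %| #[g]%g)%N -> semisimple_mx (rG g).
Proof.
move=> gG pg V stV.
have sgG : <[g]>%g \subset G by rewrite cycle_subG.
have p'g : ([pchar K]^').-group%g <[g]>%g.
  rewrite /pgroup (eq_pnat _ (eq_negn (pcharf_eq pK))).
  by rewrite p'natE ?(pcharf_prime pK).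
have modV : mxmodule (subg_repr rG sgG) V.
  apply/mxmoduleP=> h /cycleP[k ->]; rewrite -[subg_repr rG sgG _]/(rG (g ^+ k)%g).
  elim: k => [|k IHk]; first by rewrite expg0 repr_mx1 mulmx1.
  by rewrite expgS repr_mxM ?groupX // mulmxA (submx_trans (submxMr _ stV)).
have [X modX defX dX] := mx_Maschke_pchar (subg_repr rG sgG) p'g modV (submx1 V).
exists X; split=> //; have /mxmoduleP := modX; apply; exact: cycle_id.
Qed.

End Semisimple.

(** * Weak adequacy *)

Section SpanDuality.

Variables (K : fieldType) (n : nat).

(** Compose the projection along M with a coordinate that is nonzero on some X
    outside M, and represent this linear form by the trace pairing. *)
Lemma separating_matrix (M : {vspace 'M[K]_n}) : M <> fullv ->
  exists2 Y : 'M[K]_n, Y != 0 & forall X, X \in M -> \tr (X *m Y) = 0.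
Proof.
move=> Mfull; have [X XM] : exists X, X \notin M.
  apply: contrapT => noX; apply: Mfull; apply/vspaceP=> X; rewrite memvf.
  by apply/negPn/negP => XM; apply: noX; exists X.
pose g Z := Z - projv M Z.
have [a [b gX]] : exists a b, g X a b != 0.
  apply: contrapT => noab; case/negP: XM.
  suff /eqP : g X = 0 by rewrite subr_eq0 => /eqP ->; exact: memv_proj.
  apply/matrixP=> a b; rewrite [RHS]mxE; apply: contrapT => /eqP gab.
  by apply: noab; exists a, b.
pose Y : 'M[K]_n := \matrix_(i, l) g (delta_mx l i) a b.
have YE Z : \tr (Z *m Y) = g Z a b.
  have -> : g Z = \sum_i \sum_l Z i l *: g (delta_mx i l).
    rewrite /g {1 2}[Z]matrix_sum_delta linear_sum -sumrB; apply: eq_bigr => i _.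
    rewrite linear_sum -sumrB; apply: eq_bigr => l _.
    by rewrite linearZ /= scalerBr.
  rewrite summxE; apply: eq_bigr => i _; rewrite summxE mxE.
  by apply: eq_bigr => l _; rewrite !mxE.
exists Y; first by apply: contraNneq gX => Y0; rewrite -YE Y0 mulmx0 raddf0.
by move=> Z ZM; rewrite YE /g projv_id // subrr mxE.
Qed.

Lemma trace_form_nondegenerate (Y : 'M[K]_n) : (forall X, \tr (X *m Y) = 0) -> Y = 0.
Proof.
move=> trY; apply/matrixP=> i l; rewrite mxE -(trY (delta_mx l i)).
rewrite /mxtrace (bigD1 l) //= big1 ?addr0 => [|k kl].
  rewrite mxE (bigD1 i) //= big1 ?addr0 => [|k ki]; rewrite !mxE ?eqxx ?mul1r //.
  by rewrite (negPf ki) andbF mul0r.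
by rewrite mxE big1 // => k' _; rewrite !mxE (negPf kl) mul0r.
Qed.

End SpanDuality.

Section Adequacy.

Variables (F : finFieldType) (K : closedFieldType) (j : {rmorphism F -> K}).
Variables (n : nat) (rG : mx_representation K (SL2_group F) n).
Hypotheses (irrG : mx_irreducible rG) (q_gt3 : (3 < #|F|)%N).

(** The traces of the elements being unchanged by conjugation, Y may be replaced
    by a nonzero combination of its conjugates by the U x that commutes
    with all of them. *)
Lemma trace_pairing_eq0 (Y : 'M[K]_n) : \tr Y = 0 ->
    (forall a b c d, a * d - b * c = 1 -> a + d != 2 -> a + d != -2 ->
       \tr (rho rG a b c d *m Y) = 0) ->
  Y = 0.
Proof.
move=> trY trYss; apply/eqP/negPn/negP => Y0.
have : upper rG (- 0) *m Y *m upper rG 0 != 0 by rewrite oppr0 U0 mul1mx mulmx1.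
case/(moment_fixed j (e := fun x => upper rG (- x) *m Y *m upper rG x)) => k [].
set Z := \sum_x _ => Z0 ZU.
have {}ZU y : Z *m upper rG y = upper rG y *m Z.
  have conjZ : upper rG y *m Z *m upper rG (- y) = Z.
    rewrite -{2}(ZU (- y)) mulmx_sumr mulmx_suml; apply: eq_bigr => x _.
    rewrite -scalemxAr -scalemxAl; congr (_ *: _).
    by rewrite !mulmxA UD -[LHS]mulmxA UD opprB.
  by rewrite -{1}conjZ -[LHS]mulmxA UD addNr U0 mulmx1.
pose f : {scalar 'M[K]_n} := mxtrace \o mulmxr Z.
have fE X : f X = \tr (X *m Z) by [].
have fU y X : f (upper rG y *m X) = f (X *m upper rG y).
  by rewrite !fE -!mulmxA mxtrace_mulC -mulmxA ZU.
have fZ X : f X = \sum_x j x ^+ k * \tr (upper rG x *m X *m upper rG (- x) *m Y).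
  rewrite fE mulmx_sumr raddf_sum; apply: eq_bigr => x _.
  rewrite /= -scalemxAr mxtraceZ; congr (_ * _).
  by rewrite mulmxA mxtrace_mulC !mulmxA.
have f1 : f 1%:M = 0.
  by rewrite fZ big1 // => x _; rewrite mulmx1 UD subrr U0 mul1mx trY mulr0.
have f_ss a b c d : a * d - b * c = 1 -> a + d != 2 -> a + d != -2 ->
    f (rho rG a b c d) = 0.
  move=> D t2 t2'; rewrite fZ big1 // => x _.
  rewrite upper_conj //.
  have trE : a + x * c + (d - x * c) = a + d by ring.
  by rewrite trYss ?mulr0 ?trE // -D; ring.
have f0 a b c d : a * d - b * c = 1 -> f (rho rG a b c d) = 0.
  have [m [v hv]] := highest_weight_exists j irrG.
  have [N00|N00] := eqVneq (upper_sum rG) 0.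
    exact: (f_eq0_noSum irrG q_gt3 fU f1 f_ss N00 hv).
  exact: (f_eq0_Steinberg irrG q_gt3 fU f1 f_ss N00 hv).
case/eqP: Z0; apply: trace_form_nondegenerate => X.
have /andP[_ full] := group_closure_closed_field irrG.
have /envelop_mxP[a ->] : (X \in enveloping_algebra_mx rG)%MS by apply: submx_full.
rewrite -fE linear_sum big1 // => g gG; rewrite linearZ.
have [a' [b [c [d [D ->]]]]] := sl2P gG.
by rewrite -[rG _]/(rho rG a' b c d) f0 //= mulr0.
Qed.

End Adequacy.

Theorem proposition9p1 (p r : nat) (p_prime : prime p) (r_ge1 : (1 <= r)%N)
  (F : finFieldType) (cardF : #|F| = (p ^ r)%N)
  (K : closedFieldType) (iota : {rmorphism 'F_p -> K})
  (algK : algebraic_over iota)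
  (q_gt3 : (3 < p ^ r)%N)
  (n : nat) (rG : mx_representation K (SL2_group F) n)
  (irrV : mx_irreducible rG) (ntV : nontrivial_repr rG) :
  weakly_adequate rG.
Proof.
have pF : p \in [pchar F].
  have [p' p'_pr p'F] := finPcharP F.
  suff -> : p = p' by [].
  apply/eqP; rewrite -dvdn_prime2 //.
  have : (p %| #|pPrimeCharType p'F|)%N.
    by rewrite -[#|_|]/(#|F|) cardF dvdn_exp.
  by rewrite card_pprimeChar Euclid_dvdX // => /andP[].
have pK : p \in [pchar K] by rewrite (fmorph_pchar iota) pchar_Fp.
have [j _] := finField_embedding pF iota.
rewrite -cardF in q_gt3.
apply: contrapT => /separating_matrix[Y Y0 YM]; case/eqP: Y0.
have tr0 g : g \in SL2_group F -> ~~ (p %| #[g]%g)%N -> \tr (rG g *m Y) = 0.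
  move=> gG pg; apply: YM; apply/memv_span/imageP; exists g => //.
  by rewrite inE gG; apply/asboolP; exact: (semisimple_p' pK gG pg).
apply: (trace_pairing_eq0 j irrV q_gt3) => [|a b c d D t2 t2'].
  have := tr0 1%g (group1 _); rewrite repr_mx1 mul1mx order1; apply.
  by rewrite dvdn1 neq_ltn prime_gt1 ?orbT.
apply: tr0; first exact: sl2_in.
apply/negP => /(trace_of_p_element pF D) t4.
have : (a + d - 2) * (a + d + 2) = 0.
  by transitivity ((a + d) ^+ 2 - 4); [ring | rewrite t4 subrr].
by move/eqP; rewrite mulf_eq0 subr_eq0 addr_eq0 (negPf t2) (negPf t2').
Qed.
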